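(* Let $G$ be a (finite, simple) graph with $m$ edges and let $\lambda_1$ be the largest eigenvalue of its adjacency matrix. If $\lambda_1^2\geq m$, then \[ bk(G)>\frac{1}{12}\sqrt[4]{m}, \] unless $G$ is a complete bipartite graph with possibly some isolated vertices.
   Context: The booksize $bk(G)$ of a graph $G$ is the maximum number of triangles of $G$ sharing a common edge, i.e. $bk(G)=\max_{\{u,v\}\in E(G)}|N(u)\cap N(v)|$, where $N(u)$ denotes the set of neighbors of $u$. *)

(* Defs.v *)
From mathcomp Require Import all_boot all_order all_algebra.
From mathcomp Require Import reals exp.

Set Implicit Arguments.
Unset Strict Implicit.
Unset Printing Implicit Defensive.

Import Order.TTheory GRing.Theory Num.Theory.

Local Open Scope ring_scope.

(* A finite simple graph is a symmetric, irreflexive relation e on a finType. *)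

Definition edges (T : finType) (e : rel T) : {set {set T}} :=
  [set [set p.1; p.2] | p : T * T & e p.1 p.2].

Definition nbrs (T : finType) (e : rel T) (u : T) : {set T} :=
  [set v | e u v].

(* The value is 0 when there is no edge. *)
Definition booksize (T : finType) (e : rel T) : nat :=
  (\max_(p : T * T | e p.1 p.2) #|nbrs e p.1 :&: nbrs e p.2|)%N.

Definition adjacency (R : realType) (T : finType) (e : rel T) : 'M[R]_#|T| :=
  \matrix_(i, j) (e (enum_val i) (enum_val j))%:R.

Definition largest_eigenvalue (R : realType) (n : nat) (A : 'M[R]_n) (a : R) :
    Prop :=
  eigenvalue A a /\ forall b : R, eigenvalue A b -> b <= a.

(* Vertices outside A :|: B are isolated. The parts may be empty, so that
   edgeless graphs are covered; as soon as there is an edge both parts are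
   nonempty. *)
Definition complete_bipartite_with_isolated (T : finType) (e : rel T) : Prop :=
  exists A B : {set T}, [disjoint A & B] /\
    forall x y : T,
      e x y = (x \in A) && (y \in B) || (x \in B) && (y \in A).

(* Main.v *)
(* Let x be a Perron eigenvector for the spectral radius r, scaled so that its
   maximum is x_u = 1, let N be the neighbourhood of u and S its complement.
   Evaluating A^2 x = r^2 x at u and using r^2 >= m gives
     2 e(S) + 2 sum_S d_N(v) (1 - x_v) <= sum_N d_N(v) (2 x_v - 1),
   so edges inside S and defects of the bipartite graph between N and S have to
   be paid for by edges ww' inside N with x_w + x_w' > 1.  The ends of such an
   edge have at most b = bk(G) common neighbours, hence the lighter end misses
   S-vertices of total weight at least r/2 - 2b, and these missing pairs lower
   the weights on S.  Since d_N <= b on N, this costs more than is gained as soon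
   as r > 8b; so when 12 b <= r every term vanishes and G is complete bipartite
   up to isolated vertices.  As sqrt m <= r, this yields even 12 bk(G) > sqrt m. *)

Require Import Defs.
From mathcomp Require Import all_boot all_order all_algebra.
From mathcomp Require Import boolp classical_sets reals topology normedtype derive exp.
From mathcomp Require Import ring lra.

Set Implicit Arguments.
Unset Strict Implicit.
Unset Printing Implicit Defensive.

Import Order.TTheory GRing.Theory Num.Theory.
Import numFieldNormedType.Exports.

Local Open Scope ring_scope.

(** * Quadratic forms and the Perron eigenvector of a nonnegative symmetric matrix *)

Definition mxform (R : realType) n (A : 'M[R]_n) (x : 'rV[R]_n) : R :=
  \sum_i \sum_j x 0 i * A i j * x 0 j.

Definition sqnorm (R : realType) n (x : 'rV[R]_n) : R := \sum_i x 0 i ^+ 2.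

Lemma mxformE (R : realType) n (A : 'M[R]_n) x :
  mxform A x = (x *m A *m x^T) 0 0.
Proof.
rewrite /mxform exchange_big /= mxE; apply: eq_bigr => j _.
by rewrite !mxE mulr_suml.
Qed.

Lemma sqnormE (R : realType) n (x : 'rV[R]_n) : sqnorm x = (x *m x^T) 0 0.
Proof. by rewrite /sqnorm mxE; apply: eq_bigr => i _; rewrite mxE expr2. Qed.

Lemma sqnorm_ge0 (R : realType) n (x : 'rV[R]_n) : 0 <= sqnorm x.
Proof. by apply: sumr_ge0 => i _; rewrite sqr_ge0. Qed.

Lemma sqnorm_eq0 (R : realType) n (x : 'rV[R]_n) : (sqnorm x == 0) = (x == 0).
Proof.
apply/idP/eqP => [|->]; last first.
  by rewrite /sqnorm big1 // => i _; rewrite mxE expr0n.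
rewrite psumr_eq0 => [/allP x0|i _]; last exact: sqr_ge0.
apply/rowP => i; have := x0 i (mem_index_enum i).
by rewrite /= sqrf_eq0 mxE => /eqP.
Qed.

Lemma mxform_scalar_sub (R : realType) n (A : 'M[R]_n) (r : R) x :
  mxform (r%:M - A) x = r * sqnorm x - mxform A x.
Proof.
by rewrite !mxformE sqnormE mulmxBr mul_mx_scalar mulmxBl -scalemxAl !mxE.
Qed.

(** [x] minimises the nonnegative form, so the first variation [2 * t * sqnorm z] in the direction
    [z = x *m C] must vanish. *)
Lemma psd_isotropic_ker (R : realType) n (C : 'M[R]_n) x :
    C^T = C -> (forall z, 0 <= mxform C z) -> mxform C x = 0 ->
  x *m C = 0.
Proof.
move=> Csym Cpsd Cx; set z := x *m C.
have expand (t : R) : mxform C (x + t *: z) = 2 * t * sqnorm z + t ^+ 2 * mxform C z.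
  rewrite mxformE mulmxDl linearD /= !mulmxDr !mulmxDl linearZ /= -!scalemxAr.
  rewrite -!scalemxAl -/z.
  have -> : z *m C *m x^T = z *m z^T by rewrite -mulmxA /z trmx_mul Csym.
  have addE (M N : 'M[R]_1) : (M + N) 0 0 = M 0 0 + N 0 0 by rewrite mxE.
  have scaleE a (M : 'M[R]_1) : (a *: M) 0 0 = a * M 0 0 by rewrite mxE.
  by rewrite !(addE, scaleE) -sqnormE -!mxformE Cx; ring.
(* This choice of [t] makes the value a negative multiple of [sqnorm z ^+ 2]; the [+ 1] keeps the
   denominator positive even when the form vanishes at [z]. *)
have := Cpsd (x + (- sqnorm z / (mxform C z + 1)) *: z).
rewrite expand; move: (Cpsd z); set f := mxform C z => f0.
set s := sqnorm z => H.
apply/eqP; rewrite -sqnorm_eq0 -/s.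
have f1 : f + 1 != 0 by apply: lt0r_neq0; lra.
have E : (2 * (- s / (f + 1)) * s + (- s / (f + 1)) ^+ 2 * f) * (f + 1) ^+ 2 =
   - (s ^+ 2 * (f + 2)) by field.
have := mulr_ge0 H (sqr_ge0 (f + 1)); rewrite E oppr_ge0 pmulr_lle0; last lra.
by move=> s0; rewrite -sqrf_eq0 eq_le s0 sqr_ge0.
Qed.

Lemma mxform_normr (R : realType) n (A : 'M[R]_n) x :
  (forall i j, 0 <= A i j) ->
  `|mxform A x| <= mxform A (\row_i `|x 0 i|).
Proof.
move=> A0; apply: le_trans (ler_norm_sum _ _ _) _; apply: ler_sum => i _.
apply: le_trans (ler_norm_sum _ _ _) _; apply: ler_sum => j _.
by rewrite !normrM !mxE (ger0_norm (A0 i j)).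
Qed.

Lemma sqnorm_normr (R : realType) n (x : 'rV[R]_n) :
  sqnorm (\row_i `|x 0 i|) = sqnorm x.
Proof. by apply: eq_bigr => i _; rewrite mxE real_normK ?num_real. Qed.

(** The unit sphere is closed in the box [[-1, 1]^n], hence compact, so the form attains its maximum
    there; homogeneity extends the bound to all [x]. *)
Lemma mxform_max (R : realType) n (A : 'M[R]_n) : (0 < n)%N ->
  exists2 c : 'rV[R]_n, sqnorm c = 1 &
    forall x, mxform A x <= mxform A c * sqnorm x.
Proof.
move=> n0; pose K : set 'rV[R]_n := [set x | sqnorm x = 1]%classic.
have qc B : continuous (@mxform R n B).
  apply: continuous_big => [|i _]; first exact: add_continuous.
  apply: continuous_big => [|j _]; first exact: add_continuous.
  move=> x; have ck k := @coord_continuous R 1 n 0 k x.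
  exact: (cvgM (cvgM (ck i) (cvg_cst (B i j))) (ck j)).
have snc : continuous (@sqnorm R n).
  rewrite (_ : @sqnorm R n = mxform 1%:M); first exact: qc.
  by apply/funext => x; rewrite mxformE mulmx1 sqnormE.
have Kc : compact K.
  have box := @rV_compact R n (fun=> `[-1, 1]%classic)
    (fun=> @segment_compact R (-1) 1).
  apply: (subclosed_compact _ box).
  - exact: (proj1 (continuous_closedP _) snc _ (@closed_eq R 1)).
  - move=> x Kx i; rewrite /= in_itv /= -ler_norml.
    rewrite -(@expr_le1 _ 2) // real_normK ?num_real // -[leRHS]Kx /sqnorm.
    by rewrite (bigD1 i) //= lerDl sumr_ge0 // => j _; exact: sqr_ge0.
have K0 : (K !=set0)%classic.
  exists (delta_mx 0 (Ordinal n0)); rewrite /K /= /sqnorm (bigD1 (Ordinal n0)) //=.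
  rewrite big1 ?mxE ?eqxx ?expr1n ?addr0 // => i /negbTE ni.
  by rewrite mxE eqxx ni expr0n.
have [c cK cmax] := compact_EVT_max K0 Kc (continuous_subspaceT (qc A)).
rewrite inE /K /= in cK; exists c => // x.
have [/eqP|s0] := eqVneq (sqnorm x) 0.
  rewrite sqnorm_eq0 => /eqP ->; rewrite mxformE mul0mx mul0mx mxE.
  by rewrite (eqP (_ : sqnorm 0 == 0)) ?sqnorm_eq0 // mulr0.
have sp : 0 < sqnorm x by rewrite lt_neqAle eq_sym s0 sqnorm_ge0.
set t := (Num.sqrt (sqnorm x))^-1.
have t2 : t ^+ 2 * sqnorm x = 1.
  by rewrite /t exprVn sqr_sqrtr ?sqnorm_ge0 // mulVf.
have : t *: x \in K.
  rewrite inE /K /= sqnormE linearZ /= -scalemxAr -scalemxAl scalerA mxE -sqnormE.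
  by rewrite -expr2.
move/cmax; rewrite [leLHS]mxformE linearZ /= -scalemxAr -!scalemxAl scalerA mxE.
rewrite -mxformE -expr2 => H.
rewrite -(ler_pM2l (_ : 0 < t ^+ 2)); last first.
  by rewrite exprn_gt0 // invr_gt0 sqrtr_gt0.
by apply: le_trans H _; rewrite mulrCA t2 mulr1.
Qed.

(** Taking absolute values in a maximiser [c] of the form does not lower it, as [A] is nonnegative.
    The result [x] is therefore isotropic for the positive semidefinite [r%:M - A], hence in its
    kernel. *)
Lemma perron_eigenvector (R : realType) n (A : 'M[R]_n) (l : R) :
    A^T = A -> (forall i j, 0 <= A i j) -> eigenvalue A l ->
  exists (r : R) (x : 'rV[R]_n),
    [/\ `|l| <= r, x != 0, forall i, 0 <= x 0 i & x *m A = r *: x].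
Proof.
move=> Asym A0 /eigenvalueP [z zA z0].
have n0 : (0 < n)%N.
  by case: n A Asym A0 z zA z0 => // A _ _ z _; rewrite thinmx0 eqxx.
have [c c1 cmax] := mxform_max A n0.
set r := mxform A c in cmax; set x := \row_i `|c 0 i|.
have x1 : sqnorm x = 1 by rewrite sqnorm_normr.
have xr : mxform A x = r.
  apply/le_anti; rewrite -[X in _ <= X <= _]mulr1 -{1}x1 cmax mulr1.
  by apply: le_trans (mxform_normr _ A0); rewrite ler_norm.
exists r, x; split.
- have sz : 0 < sqnorm z by rewrite lt_neqAle eq_sym sqnorm_eq0 z0 sqnorm_ge0.
  rewrite -(ler_pM2r sz); apply: le_trans (_ : `|mxform A z| <= _).
    rewrite mxformE zA -scalemxAl mxE -sqnormE normrM.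
    by rewrite (ger0_norm (sqnorm_ge0 z)).
  apply: le_trans (mxform_normr _ A0) _.
  by rewrite -(sqnorm_normr z) cmax.
- by rewrite -sqnorm_eq0 x1 oner_eq0.
- by move=> i; rewrite mxE normr_ge0.
- apply/eqP; rewrite eq_sym -subr_eq0 -mul_mx_scalar -mulmxBr; apply/eqP.
  apply: psd_isotropic_ker.
  + by rewrite linearB /= tr_scalar_mx Asym.
  + by move=> w; rewrite mxform_scalar_sub subr_ge0 cmax.
  + by rewrite mxform_scalar_sub x1 xr mulr1 subrr.
Qed.

(** * Weighted counting between the neighbourhood N of [u] and its complement S *)

Section SpectralBook.

Variables (R : realFieldType) (T : finType) (e : rel T).
Variables (r : R) (y : T -> R) (u : T) (b : nat).

Hypothesis e_sym : symmetric e.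
Hypothesis y_ge0 : forall v, 0 <= y v.
Hypothesis y_le1 : forall v, y v <= 1.
Hypothesis yu : y u = 1.
Hypothesis y_eigen : forall v, r * y v = \sum_(w | e v w) y w.
Hypothesis codegree_le :
  forall v w, e v w -> (#|nbrs e v :&: nbrs e w| <= b)%N.
Hypothesis degree_sum_le : \sum_v \sum_w (e v w)%:R <= 2 * r ^+ 2.
Hypothesis r_gt0 : 0 < r.
Hypothesis b_le : 12 * b%:R <= r.

Let a v w : R := (e v w)%:R.
Let dN v := \sum_(w | e u w) a v w.
Let dS v := \sum_(w | ~~ e u w) a v w.
(** The gap between [r], the total weight of N, and the part of it seen by [v]. *)
Let missN v : R := \sum_(w | e u w) (1 - a v w) * y w.

Let aC v w : a v w = a w v. Proof. by rewrite /a e_sym. Qed.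
Let a_ge0 v w : 0 <= a v w. Proof. exact: ler0n. Qed.
Let a_le1 v w : a v w <= 1. Proof. by rewrite /a lern1 leq_b1. Qed.
Let dN_ge0 v : 0 <= dN v. Proof. exact: sumr_ge0. Qed.
Let dS_ge0 v : 0 <= dS v. Proof. exact: sumr_ge0. Qed.

Let sumID (F : T -> R) :
  \sum_v F v = \sum_(v | e u v) F v + \sum_(v | ~~ e u v) F v.
Proof. exact: bigID. Qed.

Lemma y_eigen_split v :
  r * y v = \sum_(w | e u w) a v w * y w + \sum_(w | ~~ e u w) a v w * y w.
Proof.
rewrite y_eigen big_mkcond /= -sumID /=.
by apply: eq_bigr => w _; rewrite /a; case: (e v w); rewrite (mul1r, mul0r).
Qed.

Lemma sum_nbr_y : \sum_(w | e u w) y w = r.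
Proof. by rewrite -y_eigen yu mulr1. Qed.

Lemma sum_codegree_le v w : e v w -> \sum_x a v x * a w x <= b%:R.
Proof.
move=> /codegree_le; rewrite -(ler_nat R); apply: le_trans.
rewrite -sum1_card natr_sum [leRHS]big_mkcond /=; apply: ler_sum => x _.
by rewrite !inE /a -natrM mulnb; case: (e v x && e w x).
Qed.

Lemma sum_codegree_part_le (P : pred T) v w :
  e v w -> \sum_(x | P x) a v x * a w x <= b%:R.
Proof.
move=> vw; apply: le_trans (sum_codegree_le vw).
rewrite [leRHS](bigID P) /= lerDl sumr_ge0 // => x _.
exact: mulr_ge0.
Qed.

(** Neighbours of [w] inside N are common neighbours of [u] and [w]. *)
Lemma dN_le w : e u w -> dN w <= b%:R.
Proof.
move=> uw; apply: le_trans (sum_codegree_part_le (e u) uw).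
by rewrite le_eqVlt; apply/orP; left; apply/eqP/eq_bigr => x ux;
   rewrite /a ux mul1r.
Qed.

Lemma sum_dS_dN : \sum_(v | e u v) dS v = \sum_(v | ~~ e u v) dN v.
Proof.
rewrite /dS exchange_big /=; apply: eq_bigr => v _.
by apply: eq_bigr => w _; rewrite aC.
Qed.

(** The equation [A^2 y = r^2 y] read at [u]: exactly [dN v] walks of length two lead from [u] to
    [v]. *)
Lemma sqr_eigenvalueE : r ^+ 2 = \sum_(v | e u v) dN v * y v + \sum_(v | ~~ e u v) dN v * y v.
Proof.
have -> : r ^+ 2 = \sum_(v | e u v) r * y v by rewrite -mulr_sumr sum_nbr_y.
rewrite -sumID; under eq_bigr do rewrite y_eigen_split -sumID.
rewrite exchange_big /=; apply: eq_bigr => v _.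
by rewrite /dN mulr_suml; apply: eq_bigr => w _; rewrite aC.
Qed.

(** Split the degree sum along N and S, where cross edges count twice, and compare it with
    [2 * r ^+ 2] expanded by [sqr_eigenvalueE]. *)
Lemma defect_le :
  \sum_(v | ~~ e u v) dS v + 2 * \sum_(v | ~~ e u v) dN v * (1 - y v) <=
  \sum_(v | e u v) dN v * (2 * y v - 1).
Proof.
have degE : \sum_v \sum_w (e v w)%:R =
    \sum_(v | e u v) dN v + 2 * \sum_(v | ~~ e u v) dN v
      + \sum_(v | ~~ e u v) dS v :> R.
  have -> : \sum_v \sum_w (e v w)%:R = \sum_v (dN v + dS v) :> R.
    by apply: eq_bigr => v _; rewrite -sumID.
  rewrite sumID /= !big_split /= sum_dS_dN; ring.
have := degree_sum_le; rewrite degE sqr_eigenvalueE.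
have -> : \sum_(v | ~~ e u v) dN v * (1 - y v) =
    \sum_(v | ~~ e u v) dN v - \sum_(v | ~~ e u v) dN v * y v.
  by rewrite -sumrB; apply: eq_bigr => v _; ring.
have -> : \sum_(v | e u v) dN v * (2 * y v - 1) =
    2 * (\sum_(v | e u v) dN v * y v) - \sum_(v | e u v) dN v.
  by rewrite mulr_sumr -sumrB; apply: eq_bigr => v _; ring.
lra.
Qed.

Lemma missN_ge0 v : 0 <= missN v.
Proof. by apply: sumr_ge0 => w _; rewrite mulr_ge0 // subr_ge0. Qed.

(** With [P] and [D] the weights seen by [v] in N and S, the eigenvector equation gives
    [y v * (r - P) = P * (1 - y v) + D], and weights at most 1 bound [P] and [D] by degrees. *)
Lemma y_missN_le v : y v * missN v <= dN v * (1 - y v) + dS v.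
Proof.
set P := \sum_(w | e u w) a v w * y w.
set D := \sum_(w | ~~ e u w) a v w * y w.
have PD : r * y v = P + D := y_eigen_split v.
have missE : missN v = r - P.
  by rewrite -sum_nbr_y -sumrB; apply: eq_bigr => w _; ring.
have PdN : P <= dN v by apply: ler_sum => w _; rewrite ler_piMr.
have DdS : D <= dS v by apply: ler_sum => w _; rewrite ler_piMr.
have -> : y v * missN v = P * (1 - y v) + D.
  rewrite missE mulrBr [y v * r]mulrC PD; ring.
by rewrite lerD // ler_wpM2r // subr_ge0.
Qed.

(* The lighter end of an edge inside N that pays in [defect_le]. *)
Let crowded w :=
  [exists w', [&& e u w', e w w', 1 < y w + y w' & y w <= y w']].

(** The heavier end [w'] has weight at least 1/2, so it sees weight at least [r / 2]. At most [b] of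
    this lies in N and at most [b] is shared with [w] in S; [w] misses the rest. *)
Lemma crowded_miss w : crowded w ->
  r / 2 - 2 * b%:R <= \sum_(v | ~~ e u v) (1 - a v w) * y v.
Proof.
case/existsP => w' /and4P[uw' ww' gt1 le_y].
have yw' : 1 / 2 <= y w' by lra.
have : r * (1 / 2) <= r * y w' by rewrite ler_pM2l.
rewrite y_eigen_split => H.
have PN : \sum_(v | e u v) a w' v * y v <= b%:R.
  by apply: le_trans (dN_le uw'); apply: ler_sum => v _; rewrite ler_piMr.
have PS : \sum_(v | ~~ e u v) a w' v * y v <=
    \sum_(v | ~~ e u v) (1 - a v w) * y v + b%:R.
  apply: le_trans (_ : \sum_(v | ~~ e u v) ((1 - a v w) * y v + a w v * a w' v)
     <= _); last first.
    by rewrite big_split lerD2l sum_codegree_part_le.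
  apply: ler_sum => v _; rewrite (aC v w) /a.
  have := y_ge0 v; have := y_le1 v.
  by case: (e w v); case: (e w' v) => /=; lra.
lra.
Qed.

Let Y := \sum_(w | e u w) (crowded w)%:R * y w.

Lemma crowdedY_ge0 : 0 <= Y.
Proof. by apply: sumr_ge0 => w _; rewrite mulr_ge0. Qed.

Lemma nbr_edge_sum (F : T -> R) :
  \sum_(w | e u w) \sum_(w' | e u w') a w w' * F w' =
  \sum_(w | e u w) dN w * F w.
Proof.
rewrite exchange_big /=; apply: eq_bigr => w _; rewrite /dN mulr_suml.
by apply: eq_bigr => v _; rewrite aC.
Qed.

(** The left side is a sum of [y w + y w' - 1] over ordered adjacent pairs in N. A positive term is
    at most the weight of its lighter end, which is crowded; each crowded [w] is charged at most
    [2 * dN w] times. *)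
Lemma surplus_le : \sum_(v | e u v) dN v * (2 * y v - 1) <= 2 * b%:R * Y.
Proof.
have symE (F : T -> R) : 2 * \sum_(w | e u w) dN w * F w =
    \sum_(w | e u w) \sum_(w' | e u w') a w w' * (F w + F w').
  under [RHS]eq_bigr do under eq_bigr do rewrite mulrDr.
  under [RHS]eq_bigr do rewrite big_split /=.
  rewrite big_split /= nbr_edge_sum mulr_natl mulr2n; congr (_ + _).
  by apply: eq_bigr => w _; rewrite mulr_suml.
apply: le_trans (_ : 2 * \sum_(w | e u w) dN w * ((crowded w)%:R * y w) <= _);
  last first.
  rewrite -mulrA ler_pM2l // mulr_sumr; apply: ler_sum => w uw.
  by rewrite ler_wpM2r ?mulr_ge0 // dN_le.
rewrite symE.
have -> : \sum_(v | e u v) dN v * (2 * y v - 1) =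
   2 * \sum_(v | e u v) dN v * (y v - 1 / 2).
  by rewrite mulr_sumr; apply: eq_bigr => v _; field.
rewrite symE; apply: ler_sum => w uw; apply: ler_sum => w' uw'.
rewrite /a; case ww': (e w w'); rewrite ?mul0r // !mul1r.
have cw := mulr_ge0 (ler0n R (crowded w)) (y_ge0 w).
have cw' := mulr_ge0 (ler0n R (crowded w')) (y_ge0 w').
have [le1|gt1] := lerP (y w + y w') 1; first lra.
have := y_le1 w; have := y_le1 w'.
have [le_y|lt_y] := lerP (y w) (y w').
  have cr : crowded w by apply/existsP; exists w'; rewrite uw' ww' gt1 le_y.
  by rewrite cr mul1r; lra.
have cr : crowded w'.
  by apply/existsP; exists w; rewrite uw e_sym ww' addrC gt1 ltW.
by rewrite cr mul1r; lra.
Qed.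

(** Count the weighted nonadjacent pairs between S and N twice: from S they are bounded by the
    defects, hence by [2 * b%:R * Y]; from the crowded vertices they amount to at least
    [Y * (r / 2 - 2 * b%:R)]. *)
Lemma crowdedY_eq0 : Y = 0.
Proof.
have up : \sum_(v | ~~ e u v) y v * missN v <= 2 * b%:R * Y.
  apply: le_trans surplus_le; apply: le_trans defect_le.
  have : 0 <= \sum_(v | ~~ e u v) dN v * (1 - y v).
    by apply: sumr_ge0 => v _; rewrite mulr_ge0 // subr_ge0.
  have : \sum_(v | ~~ e u v) y v * missN v <=
      \sum_(v | ~~ e u v) (dN v * (1 - y v) + dS v).
    by apply: ler_sum => v _; exact: y_missN_le.
  rewrite big_split /=; lra.
have low : Y * (r / 2 - 2 * b%:R) <= \sum_(v | ~~ e u v) y v * missN v.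
  under [leRHS]eq_bigr do rewrite mulr_sumr.
  rewrite exchange_big mulr_suml /=; apply: ler_sum => w uw.
  rewrite (eq_bigr (fun v => y w * ((1 - a v w) * y v))); last first.
    by move=> v _; ring.
  rewrite -mulr_sumr [_ * y w]mulrC -mulrA ler_wpM2l //.
  case cr : (crowded w); first by rewrite mul1r crowded_miss.
  by rewrite mul0r sumr_ge0 // => v _; rewrite mulr_ge0 // subr_ge0.
apply/le_anti; rewrite crowdedY_ge0 andbT.
(* The two bounds conflict for positive [Y] once [r > 8b]. *)
have k_gt0 : 0 < r / 2 - 4 * b%:R by have := r_gt0; have := b_le; lra.
rewrite -(pmulr_lle0 Y k_gt0).
lra.
Qed.

(** * Vanishing defects and the recovery of the bipartition *)

Lemma defect_le0 : \sum_(v | ~~ e u v) (dS v + 2 * (dN v * (1 - y v))) <= 0.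
Proof.
rewrite big_split /= -mulr_sumr; apply: le_trans defect_le _.
by apply: le_trans surplus_le _; rewrite crowdedY_eq0 mulr0.
Qed.

Lemma defect_term_eq0 v : ~~ e u v -> dS v = 0 /\ dN v * (1 - y v) = 0.
Proof.
move=> uv.
have t0 w : 0 <= dN w * (1 - y w) by rewrite mulr_ge0 // subr_ge0.
have s0 w : ~~ e u w -> 0 <= dS w + 2 * (dN w * (1 - y w)).
  by move=> _; rewrite addr_ge0 // mulr_ge0.
have tot0 : \sum_(v | ~~ e u v) (dS v + 2 * (dN v * (1 - y v))) = 0.
  by apply/le_anti; rewrite defect_le0 sumr_ge0.
have := psumr_eq0P s0 tot0 uv.
by have := t0 v; have := dS_ge0 v; split; lra.
Qed.

Lemma y_nbr_gt0 w : e u w -> 0 < y w.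
Proof.
move=> uw; rewrite -(pmulr_rgt0 _ r_gt0) y_eigen.
rewrite (bigD1 u) ?[e w u]e_sym //= yu.
by apply: ltr_wpDr => //; apply: sumr_ge0.
Qed.

Lemma far_independent v w : ~~ e u v -> ~~ e u w -> e v w = false.
Proof.
move=> uv uw; have [dS0 _] := defect_term_eq0 uv.
have := psumr_eq0P (fun x _ => a_ge0 v x) dS0 uw.
by rewrite /a; case: (e v w) => // /eqP; rewrite oner_eq0.
Qed.

(** The neighbour [w'] lies in N, so [dN v > 0] and the vanishing defect forces [y v = 1]. Then
    [missN v = 0], and positivity of the weights on N leaves no vertex of N missed. *)
Lemma far_complete v w w' : ~~ e u v -> e v w' -> e u w -> e v w.
Proof.
move=> uv vw' uw; have [dS0 /eqP] := defect_term_eq0 uv.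
have uw' : e u w' by apply: contraLR vw' => uw'; rewrite far_independent.
have dNp : 0 < dN v.
  rewrite /dN (bigD1 w') //= /a vw'; apply: ltr_wpDr => //.
  exact: sumr_ge0.
rewrite mulf_eq0 (gt_eqF dNp) /= subr_eq0 => /eqP y1.
have miss0 : missN v = 0.
  apply/le_anti; rewrite missN_ge0 andbT.
  by have := y_missN_le v; rewrite -y1 mul1r subrr mulr0 dS0 addr0.
have miss_ge0 x : e u x -> 0 <= (1 - a v x) * y x.
  by move=> _; rewrite mulr_ge0 // subr_ge0.
have := psumr_eq0P miss_ge0 miss0 uw.
rewrite /a; case: (e v w) => //; rewrite subr0 mul1r => /eqP.
by rewrite (gt_eqF (y_nbr_gt0 uw)).
Qed.

(** For an edge [vv'] inside N, all S-neighbours of [v] are adjacent to [v'] by [far_complete], so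
    [r * y v <= 2b < r / 2]. Every term on the right of [defect_le] is then nonpositive, hence zero,
    which excludes such edges. *)
Lemma nbr_independent w w' : e u w -> e u w' -> e w w' = false.
Proof.
have small v v' : e u v -> e u v' -> e v v' -> y v < 1 / 2.
  move=> uv uv' vv'.
  have PN : \sum_(x | e u x) a v x * y x <= b%:R.
    by apply: le_trans (dN_le uv); apply: ler_sum => x _; rewrite ler_piMr.
  have PS : \sum_(x | ~~ e u x) a v x * y x <= b%:R.
    apply: le_trans (sum_codegree_part_le (fun x => ~~ e u x) vv').
    apply: ler_sum => x ux; rewrite /a.
    case vx : (e v x); rewrite ?mul0r // [e v' x]e_sym.
    by rewrite (@far_complete x v' v) ?mul1r // e_sym.
  rewrite -(ltr_pM2l r_gt0) y_eigen_split; apply: le_lt_trans (lerD PN PS) _.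
  by have := r_gt0; have := b_le; lra.
have t0 v : e u v -> 0 <= dN v * (1 - 2 * y v).
  move=> uv; have [->|] := eqVneq (dN v) 0; first by rewrite mul0r.
  rewrite psumr_neq0 // => /hasP[v' _ /andP[uv']]; rewrite ltr0n lt0b => vv'.
  by rewrite mulr_ge0 //; have := small v v' uv uv' vv'; lra.
have tot0 : \sum_(v | e u v) dN v * (1 - 2 * y v) = 0.
  apply/le_anti; rewrite [X in _ && X]sumr_ge0 // andbT.
  rewrite -oppr_ge0 -sumrN.
  under eq_bigr do rewrite -mulrN opprB.
  apply: le_trans defect_le; apply: addr_ge0; first exact: sumr_ge0.
  by rewrite mulr_ge0 // sumr_ge0 // => v _; rewrite mulr_ge0 // subr_ge0.
move=> uw uw'; apply/negP => ww'.
have /eqP := psumr_eq0P t0 tot0 uw.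
have := small w w' uw uw' ww'; rewrite mulf_eq0 => yw /orP[/eqP dN0|/eqP]; last lra.
have /eqP := psumr_eq0P (fun x _ => a_ge0 w x) dN0 uw'.
by rewrite /a ww' oner_eq0.
Qed.

Lemma small_book_complete_bipartite : complete_bipartite_with_isolated e.
Proof.
(* One side is N, the other the vertices of S complete to N; the remaining vertices of S are
   isolated. *)
exists [set v | ~~ e u v && [forall w, e u w ==> e v w]], [set v | e u v].
split; first by rewrite -setI_eq0; apply/eqP/setP => v; rewrite !inE andbAC andNb.
have farE v w : ~~ e u v -> e u w -> e v w = [forall w, e u w ==> e v w].
  move=> uv uw; apply/idP/forallP => [vw x|/(_ w)]; last by rewrite uw.
  by apply/implyP => ux; exact: (far_complete uv vw).
move=> v w; rewrite !inE.
case uv : (e u v); case uw : (e u w); rewrite /= ?andbF ?andbT ?orbF.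
- by rewrite nbr_independent.
- by rewrite e_sym farE ?uw.
- by rewrite farE ?uv.
- by rewrite far_independent ?uv ?uw.
Qed.

End SpectralBook.

(** * Passage from graphs to the weighted setting, and the conclusion *)

(** Each edge is the image of at most two ordered pairs, [(x, y)] and [(y, x)]. *)
Lemma degree_sum_le_edges (T : finType) (e : rel T) : irreflexive e ->
  (\sum_v \sum_w e v w <= 2 * #|edges e|)%N.
Proof.
move=> e_irr; pose D := [set p : T * T | e p.1 p.2].
have -> : (\sum_v \sum_w e v w = #|D|)%N.
  rewrite pair_big /= -sum1_card big_mkcond [RHS]big_mkcond /=.
  by apply: eq_bigr => -[v w] _; rewrite inE /=; case: (e v w).
have -> : edges e = [set [set p.1; p.2] | p in D].
  by apply/setP => s; apply/imsetP/imsetP => -[p pD ->];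
     exists p => //; rewrite !inE in pD *.
rewrite -sum1_card (partition_big_imset (fun p : T * T => [set p.1; p.2])) /=.
rewrite mulnC -sum_nat_const; apply: leq_sum => _ /imsetP[[x y] xyD ->] /=.
rewrite sum1dep_card.
apply: leq_trans (_ : #|[set (x, y); (y, x)]| <= 2)%N; last first.
  by rewrite cards2; case: (_ != _).
apply: subset_leq_card; apply/fintype.subsetP => -[v w]; rewrite !inE /=.
case/andP => vw /eqP E.
have nvw : v != w by apply: contraTneq vw => ->; rewrite e_irr.
have : v \in [set x; y] by rewrite -E set21.
have : w \in [set x; y] by rewrite -E set22.
move: nvw; rewrite !inE => nvw /orP[] /eqP Ew /orP[] /eqP Ev;
  by move: nvw; rewrite Ev Ew !eqxx ?orbT.
Qed.

Lemma graph_perron_vector (R : realType) (T : finType) (e : rel T) (l : R) :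
    symmetric e -> eigenvalue (adjacency R e) l ->
  exists (r : R) (y : T -> R) (u : T),
    [/\ `|l| <= r, forall v, 0 <= y v, forall v, y v <= 1, y u = 1 &
       forall v, r * y v = \sum_(w | e v w) y w].
Proof.
move=> e_sym l_eig; set A := adjacency R e.
have Asym : A^T = A by apply/matrixP => i j; rewrite !mxE e_sym.
have A0 i j : 0 <= A i j by rewrite mxE.
have [r [x [lr x0 x_ge0 xA]]] := perron_eigenvector Asym A0 l_eig.
pose z v := x 0 (enum_rank v).
have z_eigen v : r * z v = \sum_(w | e v w) z w.
  have /rowP/(_ (enum_rank v)) := xA; rewrite !mxE => <-.
  rewrite (reindex enum_rank) /=; last exact/onW_bij/enum_rank_bij.
  rewrite [RHS]big_mkcond; apply: eq_bigr => w _.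
  by rewrite mxE !enum_rankK e_sym; case: (e v w); rewrite (mulr1, mulr0).
have [i xi] : exists i, x 0 i != 0.
  by apply/existsP; apply: contraNT x0 => /existsPn x0; apply/eqP/rowP => i;
     rewrite mxE; apply/eqP; have := x0 i; rewrite negbK.
(* [enum_val i] witnesses that [T] is inhabited; its nonzero entry also makes the maximum positive,
   so that dividing by [z u] is legitimate. *)
pose u := [arg max_(v > enum_val i) z v]%O.
have u_max v : z v <= z u.
  by rewrite /u; case: Order.TotalTheory.arg_maxP => // k _ /(_ v isT).
have zu : 0 < z u.
  apply: lt_le_trans (u_max (enum_val i)).
  by rewrite /z enum_valK lt_neqAle eq_sym xi x_ge0.
exists r, (fun v => z v / z u), u; split => //.
- by move=> v; rewrite divr_ge0 ?x_ge0.
- by move=> v; rewrite ler_pdivrMr // mul1r.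
- by rewrite divff ?gt_eqF.
- by move=> v; rewrite mulrA z_eigen mulr_suml.
Qed.

Theorem theorem1 (R : realType) (T : finType) (e : rel T)
    (e_sym : symmetric e) (e_irr : irreflexive e)
    (m : nat) (m_edges : #|edges e| = m)
    (lambda1 : R) (lambda1_max : largest_eigenvalue (adjacency R e) lambda1)
    (lambda1_ge : m%:R <= lambda1 ^+ 2) :
  ~ complete_bipartite_with_isolated e ->
  1 / 12 * (m%:R `^ (1 / 4)) < (booksize e)%:R :> R.
Proof.
move=> not_cb; rewrite ltNge; apply/negP => b_le; apply: not_cb.
(* An edgeless graph is covered by two empty parts. *)
have [m0|m_gt0] := posnP m.
  exists finset.set0, finset.set0; split=> [|v w].
    by rewrite -setI_eq0 finset.set0I.
  rewrite !inE; apply/negP => vw.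
  have : [set v; w] \in edges e.
    by apply/imsetP; exists (v, w); rewrite ?inE.
  by rewrite (cards0_eq (etrans m_edges m0)) inE.
have [r [y [u [lr y0 y1 yu y_eigen]]]] :=
  graph_perron_vector e_sym lambda1_max.1.
have r_ge0 : 0 <= r by apply: le_trans lr.
have m_le : m%:R <= r ^+ 2.
  apply: le_trans lambda1_ge _.
  by rewrite -[lambda1 ^+ 2]real_normK ?num_real // lerXn2r ?nnegrE.
have r_gt0 : 0 < r.
  rewrite lt_neqAle r_ge0 andbT eq_sym; apply: contraTneq m_le => ->.
  by rewrite expr0n /= -ltNge ltr0n.
(* As [1 <= m], the fourth root is at most the square root, which is at most [r]; the negated
   conclusion thus yields [12 * b <= r]. *)
have quarter : m%:R `^ (1 / 4) <= r.
  apply: le_trans (_ : m%:R `^ 2^-1 <= r).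
    by apply: ler_powR; [rewrite ler1n | lra].
  by rewrite powR12_sqrt // -(ger0_norm r_ge0) -sqrtr_sqr ler_sqrt ?sqr_ge0.
apply: (@small_book_complete_bipartite R T e r y u (booksize e)) => //.
- move=> v w vw.
  exact: (@leq_bigmax_cond _ (fun p => e p.1 p.2)
    (fun p => #|nbrs e p.1 :&: nbrs e p.2|) (v, w)).
- apply: le_trans (_ : 2 * m%:R <= _); last by rewrite ler_pM2l.
  have := degree_sum_le_edges e_irr.
  rewrite m_edges -(ler_nat R) natrM natr_sum.
  by under eq_bigr do rewrite natr_sum.
- lra.
Qed.
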